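(* (Soundness with cut rule) If a sequent $D\vdash\boldsymbol\Lambda$ is derivable in the proof system extended with proofs with cuts and the cut rule, then $[\![D]\!]\models\boldsymbol\Lambda$.
   Context: Fix a signature (names $A$ with arities $\mathsf{ar}$) and a countable set of variables. Designs are possibly infinite terms coinductively generated by: positive $P ::= \Omega \mid \bigwedge\{S_i : i\in I\}$ ($I$ arbitrary); predesigns $S ::= N_0\,|\,\overline{a}\langle N_1,\dots,N_n\rangle$ ($\mathsf{ar}(a)=n$); negative $N ::= x \mid \sum a(\vec x).P_a$ (one component for each $a\in A$, $\vec x$ distinct bound variables of length $\mathsf{ar}(a)$); up to $\alpha$-renaming and set-like treatment of conjunctions, $\bigwedge\{S\}=S$, $\maltese:=\bigwedge\emptyset$. A cut is a predesign $(\sum a(\vec x).P_a)\,|\,\overline b\langle\vec N\rangle$; an identity is a subdesign that is a bare variable in negative position. Reduction: $P\rightsquigarrow Q$ iff $P$ has a cut conjunct $(\sum a(\vec x).P_a)\,|\,\overline b\langle\vec N\rangle$ and $Q=P_b[\vec N/\vec x]$. Normal form (corecursive): $[\![P]\!]=\Omega$ if some reduction sequence from $P$ is infinite or ends in $\Omega$; otherwise $[\![P]\!]$ is the conjunction of all $x\,|\,\overline a\langle[\![\vec N]\!]\rangle$ with $x|\overline a\langle\vec N\rangle$ a conjunct of some $Q$, $P\rightsquigarrow^*Q$; $[\![\sum a(\vec x).P_a]\!]=\sum a(\vec x).[\![P_a]\!]$, $[\![x]\!]=x$. Standard design: $\neq\Omega$, cut-free and identity-free, i.e. generated by $P::=\Omega\mid\bigwedge\{S_i\}$,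 $S::=x\,|\,\overline a\langle N_1,\dots,N_n\rangle$, $N::=\sum a(\vec x).P_a$. Atomic positive: standard, free variables among a fixed variable $x_0$; atomic negative: standard and closed. $P\perp N$ iff $[\![P[N/x_0]]\!]=\maltese$; $\mathbf{X}^\perp$ = atomic designs of opposite polarity orthogonal to every element of $\mathbf{X}$; a behaviour is a set $\mathbf X$ of atomic designs of one polarity with $\mathbf X^{\perp\perp}=\mathbf X$. Positive context $\boldsymbol\Gamma=x_1:\mathbf P_1,\dots,x_n:\mathbf P_n$; negative context $\boldsymbol\Gamma,\mathbf N$. $P\models\boldsymbol\Gamma$ iff $P$ standard, $\mathsf{fv}(P)\subseteq\{x_1,\dots,x_n\}$, $[\![P[K_1/x_1,\dots,K_n/x_n]]\!]=\maltese$ for all $K_i\in\mathbf P_i^\perp$; $N\models\boldsymbol\Gamma,\mathbf N$ iff $N$ standard, $\mathsf{fv}(N)\subseteq\{x_1,\dots,x_n\}$, $[\![Q[N[\vec K/\vec x]/x_0]]\!]=\maltese$ for all $K_i\in\mathbf P_i^\perp$, $Q\in\mathbf N^\perp$. Logical connective $\alpha=(z_1,\dots,z_n,\alpha_0)$: distinct variables $z_i$, finite set $\alpha_0$ of negative actions $a(\vec x)$ ($\vec x$ a list of $\mathsf{ar}(a)$ distinct variables among the $z_i$) with distinct names, identified up to renaming. $\overline a\langle\mathbf N_1,\dots,\mathbf N_m\rangle:=\{x_0\,|\,\overline a\langle N_1,\dots,N_m\rangle : N_j\in\mathbf N_j\}$; $\overline\alpha\langle\mathbf N_1,\dots,\mathbf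 N_n\rangle:=\big(\bigcup_{a(\vec x)\in\alpha_0}\overline a\langle\mathbf N_{i_1},\dots,\mathbf N_{i_m}\rangle\big)^{\perp\perp}$ with $\vec x=z_{i_1},\dots,z_{i_m}$; $\alpha(\mathbf P_1,\dots,\mathbf P_n):=\overline\alpha\langle\mathbf P_1^\perp,\dots,\mathbf P_n^\perp\rangle^\perp$; logical behaviours are those built inductively by these two constructions. A proof with cuts is a design that is $\neq\Omega$, identity-free and all of whose conjunctions are unary (cuts allowed). A sequent is $D\vdash\boldsymbol\Gamma$ ($D$ positive) or $D\vdash\boldsymbol\Gamma,\mathbf N$ ($D$ negative), with $D$ a proof with cuts, all behaviours logical, $\mathsf{fv}(D)\subseteq\mathsf{fv}(\boldsymbol\Gamma)$. Rules (finite derivations): positive rule: from $M_j\vdash\boldsymbol\Gamma,\mathbf N_{i_j}$ ($j=1,\dots,m$) infer $z\,|\,\overline a\langle M_1,\dots,M_m\rangle\vdash\boldsymbol\Gamma$, provided $z:\overline\alpha\langle\mathbf N_1,\dots,\mathbf N_n\rangle$ is in $\boldsymbol\Gamma$, $a(\vec x)\in\alpha_0$, $\vec x=z_{i_1},\dots,z_{i_m}$; negative rule: from $P_a\vdash\boldsymbol\Gamma,z_{i_1}:\mathbf P_{i_1},\dots,z_{i_m}:\mathbf P_{i_m}$ for each $a(\vec x)\in\alpha_0$ ($\vec x=z_{i_1},\dots,z_{i_m}$ fresh) infer $\sum a(\vec x).P_a\vdash\boldsymbol\Gamma,\alpha(\mathbf P_1,\dots,\mathbf P_n)$ (other components arbitrary);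 cut rule: from $D\vdash\boldsymbol\Xi,\boldsymbol\Gamma,z:\mathbf P$ and $N\vdash\boldsymbol\Gamma,\mathbf P^\perp$ infer $D[N/z]\vdash\boldsymbol\Xi,\boldsymbol\Gamma$, where $\boldsymbol\Xi$ is empty or a single negative logical behaviour. *)

(* Defs.v *)
From Stdlib Require Import Relations.
From mathcomp Require Import all_boot.
From mathcomp Require Import boolp classical_sets functions cardinality.

Set Implicit Arguments.
Unset Strict Implicit.
Unset Printing Implicit Defensive.

Local Open Scope classical_set_scope.

Section Designs.
Variables (A : Type) (ar : A -> nat).

(* Designs are in de Bruijn form, which makes alpha-renaming trivial: in
   [Sum F], the component [F a] binds the variables [0, ..., ar a - 1], and the
   variable [x] of the surrounding scope is called [ar a + x] inside [F a].
   Free variables at top level are natural numbers used as plain names. *)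
CoInductive pos : Type :=
| Omega
| Conj (I : Type) (S : I -> pre)
with pre : Type :=
| Pre (N0 : neg) (a : A) (N : 'I_(ar a) -> neg)
with neg : Type :=
| Var (x : nat)
| Sum (F : A -> pos).

Definition single (S : pre) : pos := Conj (fun _ : unit => S).
Definition daimon : pos := Conj (fun i : void => match i return pre with end).

Inductive design : Type := DPos of pos | DNeg of neg.

(* Equality of designs: conjunctions are compared as sets. *)
CoInductive pos_eq : pos -> pos -> Prop :=
| Omega_eq : pos_eq Omega Omega
| Conj_eq I J (S : I -> pre) (T : J -> pre) :
    (forall i, exists j, pre_eq (S i) (T j)) ->
    (forall j, exists i, pre_eq (S i) (T j)) ->
    pos_eq (Conj S) (Conj T)
with pre_eq : pre -> pre -> Prop :=
| Pre_eq N0 M0 a (N M : 'I_(ar a) -> neg) :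
    neg_eq N0 M0 -> (forall j, neg_eq (N j) (M j)) ->
    pre_eq (Pre N0 N) (Pre M0 M)
with neg_eq : neg -> neg -> Prop :=
| Var_eq x : neg_eq (Var x) (Var x)
| Sum_eq (F G : A -> pos) :
    (forall a, pos_eq (F a) (G a)) -> neg_eq (Sum F) (Sum G).

Definition design_eq (D E : design) : Prop :=
  match D, E with
  | DPos P, DPos Q => pos_eq P Q
  | DNeg N, DNeg M => neg_eq N M
  | _, _ => False
  end.

(* Renaming and simultaneous capture-avoiding substitution. *)
Definition up_ren (m : nat) (r : nat -> nat) (x : nat) : nat :=
  if x < m then x else m + r (x - m).

CoFixpoint ren_pos (r : nat -> nat) (P : pos) : pos :=
  match P with
  | Omega => Omega
  | Conj _ T => Conj (fun i => ren_pre r (T i))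
  end
with ren_pre (r : nat -> nat) (S : pre) : pre :=
  let: Pre N0 a N := S in Pre (ren_neg r N0) (fun j => ren_neg r (N j))
with ren_neg (r : nat -> nat) (N : neg) : neg :=
  match N with
  | Var x => Var (r x)
  | Sum F => Sum (fun a => ren_pos (up_ren (ar a) r) (F a))
  end.

Definition up (m : nat) (s : nat -> neg) (x : nat) : neg :=
  if x < m then Var x else ren_neg (addn m) (s (x - m)).

CoFixpoint subst_pos (s : nat -> neg) (P : pos) : pos :=
  match P with
  | Omega => Omega
  | Conj _ T => Conj (fun i => subst_pre s (T i))
  end
with subst_pre (s : nat -> neg) (S : pre) : pre :=
  let: Pre N0 a N := S in Pre (subst_neg s N0) (fun j => subst_neg s (N j))
with subst_neg (s : nat -> neg) (N : neg) : neg :=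
  match N with
  | Var x => s x
  | Sum F => Sum (fun a => subst_pos (up (ar a) s) (F a))
  end.

Definition subst (s : nat -> neg) (D : design) : design :=
  match D with
  | DPos P => DPos (subst_pos s P)
  | DNeg N => DNeg (subst_neg s N)
  end.

(* [N/z] *)
Definition sub1 (z : nat) (N : neg) (x : nat) : neg :=
  if x == z then N else Var x.

(* Instantiates the [m] innermost bound variables and leaves their scope. *)
Definition inst m (N : 'I_m -> neg) (x : nat) : neg :=
  if insub x is Some j then N j else Var (x - m).

Inductive fv_pos : nat -> pos -> Prop :=
| fv_conj x I (S : I -> pre) i : fv_pre x (S i) -> fv_pos x (Conj S)
with fv_pre : nat -> pre -> Prop :=
| fv_head x N0 a (N : 'I_(ar a) -> neg) : fv_neg x N0 -> fv_pre x (Pre N0 N)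
| fv_arg x N0 a (N : 'I_(ar a) -> neg) j :
    fv_neg x (N j) -> fv_pre x (Pre N0 N)
with fv_neg : nat -> neg -> Prop :=
| fv_var x : fv_neg x (Var x)
| fv_sum x F a : fv_pos (ar a + x) (F a) -> fv_neg x (Sum F).

Definition fv (D : design) : set nat :=
  match D with
  | DPos P => [set x | fv_pos x P]
  | DNeg N => [set x | fv_neg x N]
  end.

Inductive red : pos -> pos -> Prop :=
| Red I (S : I -> pre) i F b (N : 'I_(ar b) -> neg) :
    S i = Pre (Sum F) N -> red (Conj S) (subst_pos (inst N) (F b)).

Definition reds : pos -> pos -> Prop := clos_refl_trans pos red.

Definition diverges (P : pos) : Prop :=
  (exists s : nat -> pos, s 0 = P /\ forall n, red (s n) (s n.+1))
  \/ reds P Omega.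

(* The conjuncts of all reducts of [P] must index a conjunction, so they are
   enumerated by a small type of occurrences ([{Q | reds P Q}] would live in
   too large a universe); see [occurrenceP]. The reduct of a non-cut is
   [Omega], which has no conjunct, hence contributes no occurrence. *)
Definition index (P : pos) : Type :=
  match P return Type with Omega => void | Conj J _ => J end.

Definition conjunct (P : pos) : index P -> pre :=
  match P with
  | Omega => fun i : void => match i return pre with end
  | Conj _ T => T
  end.

Definition reduct (S : pre) : pos :=
  match S with
  | Pre (Var _) _ _ => Omega
  | Pre (Sum F) b N => subst_pos (inst N) (F b)
  end.

Inductive occurrence (P : pos) : Type :=
| Here (i : index P)
| There (i : index P) (o : occurrence (reduct (conjunct i))).

Fixpoint conjunct_at (P : pos) (o : occurrence P) : pre :=
  match o with
  | Here i => conjunct i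
  | There _ o' => conjunct_at o'
  end.

Definition head_var (S : pre) : bool := if S is Pre (Var _) _ _ then true else false.

(* Normal forms. In the predesign below, [N0] is a variable. *)
CoFixpoint nf_pos (P : pos) : pos :=
  if pselect (diverges P) then Omega
  else Conj (fun o : {o : occurrence P | head_var (conjunct_at o)} =>
    let: Pre N0 a N := conjunct_at (sval o) in Pre N0 (fun j => nf_neg (N j)))
with nf_neg (N : neg) : neg :=
  match N with
  | Var x => Var x
  | Sum F => Sum (fun a => nf_pos (F a))
  end.

Definition nf (D : design) : design :=
  match D with
  | DPos P => DPos (nf_pos P)
  | DNeg N => DNeg (nf_neg N)
  end.

CoInductive cut_free_pos : pos -> Prop :=
| cf_Omega : cut_free_pos Omega
| cf_Conj I (S : I -> pre) : (forall i, cut_free_pre (S i)) -> cut_free_pos (Conj S)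
with cut_free_pre : pre -> Prop :=
| cf_Pre x a (N : 'I_(ar a) -> neg) :
    (forall j, cut_free_neg (N j)) -> cut_free_pre (Pre (Var x) N)
with cut_free_neg : neg -> Prop :=
| cf_Var x : cut_free_neg (Var x)
| cf_Sum F : (forall a, cut_free_pos (F a)) -> cut_free_neg (Sum F).

(* The head [x] of [x | a<N>] does not count as an identity. *)
CoInductive id_free_pos : pos -> Prop :=
| if_Omega : id_free_pos Omega
| if_Conj I (S : I -> pre) : (forall i, id_free_pre (S i)) -> id_free_pos (Conj S)
with id_free_pre : pre -> Prop :=
| if_head x a (N : 'I_(ar a) -> neg) :
    (forall j, id_free_neg (N j)) -> id_free_pre (Pre (Var x) N)
| if_cut N0 a (N : 'I_(ar a) -> neg) :
    id_free_neg N0 -> (forall j, id_free_neg (N j)) -> id_free_pre (Pre N0 N)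
with id_free_neg : neg -> Prop :=
| if_Sum F : (forall a, id_free_pos (F a)) -> id_free_neg (Sum F).

CoInductive unary_pos : pos -> Prop :=
| un_Omega : unary_pos Omega
| un_Conj I (S : I -> pre) :
    (exists i, forall k, pre_eq (S k) (S i)) ->
    (forall i, unary_pre (S i)) -> unary_pos (Conj S)
with unary_pre : pre -> Prop :=
| un_Pre N0 a (N : 'I_(ar a) -> neg) :
    unary_neg N0 -> (forall j, unary_neg (N j)) -> unary_pre (Pre N0 N)
with unary_neg : neg -> Prop :=
| un_Var x : unary_neg (Var x)
| un_Sum F : (forall a, unary_pos (F a)) -> unary_neg (Sum F).

Definition cut_free (D : design) : Prop :=
  match D with DPos P => cut_free_pos P | DNeg N => cut_free_neg N end.
Definition id_free (D : design) : Prop :=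
  match D with DPos P => id_free_pos P | DNeg N => id_free_neg N end.
Definition unary (D : design) : Prop :=
  match D with DPos P => unary_pos P | DNeg N => unary_neg N end.

Definition standard (D : design) : Prop :=
  [/\ D <> DPos Omega, cut_free D & id_free D].

Definition proof_with_cuts (D : design) : Prop :=
  [/\ D <> DPos Omega, id_free D & unary D].

(* The distinguished variable of atomic designs. *)
Definition x0 : nat := 0.

Definition atomic_pos (P : pos) : Prop :=
  standard (DPos P) /\ fv (DPos P) `<=` [set x0].
Definition atomic_neg (N : neg) : Prop :=
  standard (DNeg N) /\ fv (DNeg N) = set0.

Definition orthogonal (P : pos) (N : neg) : Prop :=
  pos_eq (nf_pos (subst_pos (sub1 x0 N) P)) daimon.

Definition pos_orth (X : set pos) : set neg :=
  [set N | atomic_neg N /\ forall P, X P -> orthogonal P N].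
Definition neg_orth (X : set neg) : set pos :=
  [set P | atomic_pos P /\ forall N, X N -> orthogonal P N].

Definition pos_behaviour (X : set pos) : Prop :=
  X `<=` atomic_pos /\ neg_orth (pos_orth X) = X.
Definition neg_behaviour (X : set neg) : Prop :=
  X `<=` atomic_neg /\ pos_orth (neg_orth X) = X.

(* [act a = Some v] means that [a(z_(v 0), ..., z_(v (ar a - 1)))] is in
   [alpha_0]: a finite set of actions with distinct names is a finite partial
   function on names, and [z_1, ..., z_n] are identified with ['I_n]. *)
Record connective (n : nat) := Connective {
  act : forall a : A, option ('I_(ar a) -> 'I_n);
  act_inj : forall a v, act a = Some v -> injective v;
  act_finite : finite_set [set a | act a <> None]
}.

Definition action_pos (a : A) (X : 'I_(ar a) -> set neg) : set pos :=
  [set P | exists2 N : 'I_(ar a) -> neg,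
     (forall j, X j (N j)) & pos_eq P (single (Pre (Var x0) N))].

Definition conn_pos n (alpha : connective n) (X : 'I_n -> set neg) : set pos :=
  neg_orth (pos_orth [set P | exists a v,
    act alpha a = Some v /\ action_pos (fun j => X (v j)) P]).

Definition conn_neg n (alpha : connective n) (X : 'I_n -> set pos) : set neg :=
  pos_orth (conn_pos alpha (fun i => pos_orth (X i))).

Inductive logical_pos : set pos -> Prop :=
| Logical_pos n (alpha : connective n) (X : 'I_n -> set neg) :
    (forall i, logical_neg (X i)) -> logical_pos (conn_pos alpha X)
with logical_neg : set neg -> Prop :=
| Logical_neg n (alpha : connective n) (X : 'I_n -> set pos) :
    (forall i, logical_pos (X i)) -> logical_neg (conn_neg alpha X).

(* A context [G, Xi] consists of a positive part [G : ctx], the partial function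
   sending [x_i] to [P_i], and of at most one negative set [Xi : option (set neg)]. *)
Definition ctx : Type := nat -> option (set pos).

Definition dom (G : ctx) : set nat := [set x | G x <> None].

(* G, z : P *)
Definition ctx_add (G : ctx) (z : nat) (P : set pos) : ctx :=
  fun x => if x == z then Some P else G x.

(* G, 0 : P 0, ..., m-1 : P (m-1) under a binder of [m] variables *)
Definition ctx_bind m (G : ctx) (P : 'I_m -> set pos) : ctx :=
  fun x => if insub x is Some j then Some (P j) else G (x - m).

(* [K_1/x_1, ..., K_n/x_n] *)
Definition ctx_sub (G : ctx) (K : nat -> neg) (x : nat) : neg :=
  if G x is Some _ then K x else Var x.

Definition ctx_orth (G : ctx) (K : nat -> neg) : Prop :=
  forall x P, G x = Some P -> pos_orth P (K x).

Definition models (D : design) (G : ctx) (Xi : option (set neg)) : Prop :=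
  match D, Xi with
  | DPos P, None =>
      [/\ standard D, fv D `<=` dom G &
          forall K, ctx_orth G K ->
            pos_eq (nf_pos (subst_pos (ctx_sub G K) P)) daimon]
  | DNeg N, Some X =>
      [/\ standard D, fv D `<=` dom G &
          forall K Q, ctx_orth G K -> neg_orth X Q ->
            pos_eq (nf_pos (subst_pos (sub1 x0 (subst_neg (ctx_sub G K) N)) Q))
                   daimon]
  | _, _ => False
  end.

Definition same_polarity (D : design) (Xi : option (set neg)) : Prop :=
  match D, Xi with
  | DPos _, None | DNeg _, Some _ => True
  | _, _ => False
  end.

Record sequent (D : design) (G : ctx) (Xi : option (set neg)) : Prop := {
  seq_polarity : same_polarity D Xi;
  seq_proof : proof_with_cuts D;
  seq_finite : finite_set (dom G);
  seq_pos : forall x P, G x = Some P -> logical_pos P;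
  seq_neg : forall X, Xi = Some X -> logical_neg X;
  seq_fv : fv D `<=` dom G
}.

(* [der_eq] expresses that designs are taken up to [design_eq]. *)
Inductive derivable : design -> ctx -> option (set neg) -> Prop :=
| der_eq D E G Xi : design_eq D E -> derivable D G Xi -> derivable E G Xi
| der_pos G z n (alpha : connective n) (X : 'I_n -> set neg)
    a (v : 'I_(ar a) -> 'I_n) (M : 'I_(ar a) -> neg) :
    sequent (DPos (single (Pre (Var z) M))) G None ->
    (forall i, logical_neg (X i)) ->
    G z = Some (conn_pos alpha X) ->
    act alpha a = Some v ->
    (forall j, derivable (DNeg (M j)) G (Some (X (v j)))) ->
    derivable (DPos (single (Pre (Var z) M))) G None
| der_neg G n (alpha : connective n) (P : 'I_n -> set pos) (F : A -> pos) :
    sequent (DNeg (Sum F)) G (Some (conn_neg alpha P)) ->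
    (forall i, logical_pos (P i)) ->
    (forall a v, act alpha a = Some v ->
       derivable (DPos (F a)) (ctx_bind G (fun j => P (v j))) None) ->
    derivable (DNeg (Sum F)) G (Some (conn_neg alpha P))
| der_cut D N G Xi z P :
    sequent (subst (sub1 z N) D) G Xi ->
    G z = None ->
    derivable D (ctx_add G z P) Xi ->
    derivable (DNeg N) G (Some (pos_orth P)) ->
    derivable (subst (sub1 z N) D) G Xi.

Lemma occurrenceP (P : pos) (S : pre) :
  (exists o : occurrence P, conjunct_at o = S) <->
  (exists Q (i : index Q), reds P Q /\ conjunct i = S).
Proof.
split.
- case=> o; elim: o => {P} [P i <-|P i o IH oS].
    by exists P, i; split=> //; apply: rt_refl.
  have [Q [k [rQ kS]]] := IH oS; exists Q, k; split=> //.
  case: P i o rQ {IH oS} => [[]|I T] /= i o rQ.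
  move: o rQ; case E: (T i) => [[x|F] b N] /= o rQ; first by case: o => [[]|[]].
  by apply: rt_trans rQ; apply: rt_step; apply: Red E.
- case=> Q [i [/clos_rt_rt1n_iff rQ <-]].
  elim: rQ i => {P Q} [P i|P Q R PQ _ IH i]; first by exists (Here i).
  move: (IH i); move: (conjunct i) => S' {IH i}; case: PQ => {P Q} I T k F b N E.
  have <- : reduct (@conjunct (Conj T) k) = subst_pos (inst N) (F b).
    by rewrite /= E.
  by case=> o <-; exists (@There (Conj T) k o).
Qed.

Lemma neg_orthK (X : set pos) :
  X `<=` atomic_pos -> pos_orth (neg_orth (pos_orth X)) = pos_orth X.
Proof.
move=> Xa; apply/seteqP; split=> N [Na oN]; split=> // P.
  by move=> XP; apply: oN; split; [exact: Xa|move=> M [_]; apply].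
by move=> [_ oP]; apply: oP.
Qed.

Lemma pos_orthK (X : set neg) :
  X `<=` atomic_neg -> neg_orth (pos_orth (neg_orth X)) = neg_orth X.
Proof.
move=> Xa; apply/seteqP; split=> P [Pa oP]; split=> // N.
  by move=> XN; apply: oP; split; [exact: Xa|move=> Q [_]; apply].
by move=> [_ oN]; apply: oN.
Qed.

Lemma logical_pos_behaviour (X : set pos) : logical_pos X -> pos_behaviour X.
Proof. by case=> n al Y _; split; [move=> P []|apply: pos_orthK => N []]. Qed.

Lemma logical_neg_behaviour (X : set neg) : logical_neg X -> neg_behaviour X.
Proof. by case=> n al Y _; split; [move=> P []|apply: neg_orthK => N []]. Qed.

End Designs.

(* Main.v *)
(* Designs are run in an environment machine whose states are pairs of a positive
   design and an assignment of closures to its free variables; [run] says that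
   every execution ends without reaching [Omega] or a free head variable.
   Associativity of normalization is needed only in the form: replacing bodies of
   closures by their normal forms, in either direction, does not affect [run]
   ([run_nst], [run_nst_inv]).  In particular the normal form of [P] is the daimon
   iff [P] runs in the environment where all variables are stuck.  Since the machine
   never substitutes, this needs no coinductive reasoning about terms up to
   bisimilarity.  Soundness is then an induction on derivations: a negative premise
   is first closed and normalized, so that it becomes a member of its behaviour. *)

Require Import Defs.
From Stdlib Require Import Relations.
From mathcomp Require Import all_boot boolp classical_sets.

Set Implicit Arguments.
Unset Strict Implicit.
Unset Printing Implicit Defensive.

Local Open Scope classical_set_scope.

Section Soundness.
Variables (A : Type) (ar : A -> nat).

Notation pos := (pos ar).
Notation pre := (pre ar).
Notation neg := (neg ar).

(** * Unfolding and inversion of the coinductive definitions *)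

(** A cofixpoint reduces only under a match; rewriting with this identity forces one unfolding in
    the equations below. *)
Lemma posE (P : pos) : P = match P with Omega => Omega _ | Conj _ T => Conj T end.
Proof. by case: P. Qed.

Lemma preE (S : pre) : S = let: Pre N0 _ N := S in Pre N0 N.
Proof. by case: S. Qed.

Lemma negE (N : neg) : N = match N with Var x => Var _ x | Sum F => Sum F end.
Proof. by case: N. Qed.

Lemma subst_posE s (P : pos) : subst_pos s P =
  match P with Omega => Omega _ | Conj _ T => Conj (fun i => subst_pre s (T i)) end.
Proof. by rewrite {1}[LHS]posE; case: P. Qed.

Lemma subst_preE s (S : pre) : subst_pre s S =
  let: Pre N0 _ N := S in Pre (subst_neg s N0) (fun j => subst_neg s (N j)).
Proof. by rewrite {1}[LHS]preE; case: S. Qed.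

Lemma subst_negE s (N : neg) : subst_neg s N =
  match N with Var x => s x | Sum F => Sum (fun a => subst_pos (up (ar a) s) (F a)) end.
(* For a variable the unfolding leaves a match on [s x], hence the second case analysis. *)
Proof. by rewrite {1}[LHS]negE; case: N => [x|F] //=; case: (s x). Qed.

Lemma ren_posE r (P : pos) : ren_pos r P =
  match P with Omega => Omega _ | Conj _ T => Conj (fun i => ren_pre r (T i)) end.
Proof. by rewrite {1}[LHS]posE; case: P. Qed.

Lemma ren_preE r (S : pre) : ren_pre r S =
  let: Pre N0 _ N := S in Pre (ren_neg r N0) (fun j => ren_neg r (N j)).
Proof. by rewrite {1}[LHS]preE; case: S. Qed.

Lemma ren_negE r (N : neg) : ren_neg r N =
  match N with
  | Var x => Var _ (r x)
  | Sum F => Sum (fun a => ren_pos (up_ren (ar a) r) (F a))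
  end.
Proof. by rewrite {1}[LHS]negE; case: N. Qed.

Definition nf_pre (S : pre) : pre :=
  let: Pre N0 _ N := S in Pre N0 (fun j => nf_neg (N j)).

Lemma nf_posE (P : pos) : nf_pos P =
  if pselect (diverges P) then Omega _
  else Conj (fun o : {o : occurrence P | head_var (conjunct_at o)} =>
    nf_pre (conjunct_at (sval o))).
Proof. by rewrite {1}[LHS]posE /=; case: (pselect _). Qed.

Lemma nf_negE (N : neg) : nf_neg N =
  match N with Var x => Var _ x | Sum F => Sum (fun a => nf_pos (F a)) end.
Proof. by rewrite {1}[LHS]negE; case: N. Qed.

(** Inversions are phrased by matching on the designs, which avoids equations between dependent
    pairs. *)
Lemma pos_eqE (P Q : pos) : pos_eq P Q ->
  match P, Q with
  | Omega, Omega => True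
  | Conj _ U, Conj _ T => (forall i, exists j, pre_eq (U i) (T j)) /\
                          (forall j, exists i, pre_eq (U i) (T j))
  | _, _ => False
  end.
Proof. by case. Qed.

Lemma pre_eqE (S T : pre) : pre_eq S T ->
  let: Pre N0 a N := S in exists M0, exists M : 'I_(ar a) -> neg,
    [/\ T = Pre M0 M, neg_eq N0 M0 & forall j, neg_eq (N j) (M j)].
Proof. by case=> N0 M0 a N M ? ?; exists M0, M. Qed.

Lemma neg_eqE (N M : neg) : neg_eq N M ->
  match N, M with
  | Var x, Var y => x = y
  | Sum F, Sum G => forall a, pos_eq (F a) (G a)
  | _, _ => False
  end.
Proof. by case. Qed.

Lemma cut_free_posE (P : pos) : cut_free_pos P ->
  if P is Conj _ T then forall i, cut_free_pre (T i) else True.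
Proof. by case. Qed.

Lemma cut_free_preE (S : pre) : cut_free_pre S ->
  let: Pre N0 a N := S in
  (exists x, N0 = Var _ x) /\ forall j, cut_free_neg (N j).
Proof. by case=> x a N ?; split; first by exists x. Qed.

Lemma cut_free_negE (N : neg) : cut_free_neg N ->
  if N is Sum F then forall a, cut_free_pos (F a) else True.
Proof. by case. Qed.

Lemma id_free_posE (P : pos) : id_free_pos P ->
  if P is Conj _ T then forall i, id_free_pre (T i) else True.
Proof. by case. Qed.

(* A bare variable is allowed in head position, hence also as a substituted value. *)
Definition id_free_head (N : neg) : Prop :=
  if N is Var _ then True else id_free_neg N.

Lemma id_free_preE (S : pre) : id_free_pre S ->
  let: Pre N0 a N := S in id_free_head N0 /\ forall j, id_free_neg (N j).
Proof. by case=> [x a N h|M0 a N h hN]; split=> //; case: M0 h. Qed.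

Lemma id_free_negE (N : neg) : id_free_neg N ->
  if N is Sum F then forall a, id_free_pos (F a) else False.
Proof. by case. Qed.

(** * Equality of designs and the properties it preserves *)

Lemma pos_eq_refl (P : pos) : pos_eq P P
with pre_eq_refl (S : pre) : pre_eq S S
with neg_eq_refl (N : neg) : neg_eq N N.
Proof.
- case: P => [|I S]; constructor=> i; exists i; exact: pre_eq_refl.
- case: S => N0 a N; constructor=> [|j]; exact: neg_eq_refl.
- case: N => [x|F]; constructor=> a; exact: pos_eq_refl.
Qed.

Lemma pos_eq_sym (P Q : pos) : pos_eq P Q -> pos_eq Q P
with pre_eq_sym (S T : pre) : pre_eq S T -> pre_eq T S
with neg_eq_sym (N M : neg) : neg_eq N M -> neg_eq M N.
Proof.
- case: P Q => [|J S] [|K T] /pos_eqE //= [h1 h2]; constructor=> i.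
    by case: (h2 i) => j h; exists j; apply: pre_eq_sym.
  by case: (h1 i) => j h; exists j; apply: pre_eq_sym.
- case: S => N0 a N /pre_eqE [M0 [M [-> e0 e]]].
  by constructor=> [|j]; apply: neg_eq_sym.
- case: N M => [x|F] [y|G] /neg_eqE; try by case.
    by move=> ->; constructor.
  by move=> h; constructor=> a; apply: pos_eq_sym.
Qed.

Lemma cut_free_pos_eq (P Q : pos) : pos_eq P Q -> cut_free_pos P -> cut_free_pos Q
with cut_free_pre_eq (S T : pre) : pre_eq S T -> cut_free_pre S -> cut_free_pre T
with cut_free_neg_eq (N M : neg) : neg_eq N M -> cut_free_neg N -> cut_free_neg M.
Proof.
- case: P Q => [|J S] [|K T] /pos_eqE //.
  move=> [_ h] /cut_free_posE hS; constructor=> j.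
  by case: (h j) => i e; apply: cut_free_pre_eq e (hS i).
- case: S => N0 a N /pre_eqE [M0 [M [-> e0 e]]] /cut_free_preE [[x Ex] hN].
  rewrite Ex in e0; case: M0 e0 => [y|G] /neg_eqE // _.
  constructor=> j; exact: cut_free_neg_eq (e j) (hN j).
- case: N M => [x|F] [y|G] /neg_eqE //; first by constructor.
  move=> e /cut_free_negE h; constructor=> a; exact: cut_free_pos_eq (e a) (h a).
Qed.

Lemma id_free_pos_eq (P Q : pos) : pos_eq P Q -> id_free_pos P -> id_free_pos Q
with id_free_pre_eq (S T : pre) : pre_eq S T -> id_free_pre S -> id_free_pre T
with id_free_neg_eq (N M : neg) : neg_eq N M -> id_free_neg N -> id_free_neg M.
Proof.
- case: P Q => [|J S] [|K T] /pos_eqE //.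
  move=> [_ h] /id_free_posE hS; constructor=> j.
  by case: (h j) => i e; apply: id_free_pre_eq e (hS i).
- case: S => N0 a N /pre_eqE [M0 [M [-> e0 e]]] /id_free_preE [h0 hN].
  case: N0 M0 e0 h0 => [x|F] [y|G] e0 //= h0; try by move/neg_eqE: e0.
  + by apply: if_head=> j; apply: id_free_neg_eq (e j) (hN j).
  + apply: if_cut=> [|j]; first exact: id_free_neg_eq e0 h0.
    by apply: id_free_neg_eq (e j) (hN j).
- case: N M => [x|F] [y|G] /neg_eqE // e /id_free_negE h //.
  constructor=> a; exact: id_free_pos_eq (e a) (h a).
Qed.

(** * Free variables under substitution, reduction and normalization *)

(* [fv_pos] with [R] in place of [fv_neg]: the induction principle
   [fv_neg_in_ind] avoids equations between the dependent arguments of [Pre]. *)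
Definition fv_in (R : nat -> neg -> Prop) (x : nat) (P : pos) : Prop :=
  if P is Conj _ T then
    exists i, let: Pre N0 _ N := T i in R x N0 \/ exists j, R x (N j)
  else False.

Scheme fv_pos_mut := Induction for fv_pos Sort Prop
  with fv_pre_mut := Induction for fv_pre Sort Prop
  with fv_neg_mut := Induction for fv_neg Sort Prop.

Lemma fv_neg_in_ind (R : nat -> neg -> Prop) :
  (forall x, R x (Var _ x)) ->
  (forall x F a, fv_in R (ar a + x) (F a) -> R x (Sum F)) ->
  forall x N, fv_neg x N -> R x N.
Proof.
move=> RV RS; apply: (@fv_neg_mut A ar (fun x P _ => fv_in R x P)
  (fun x S _ => let: Pre N0 _ N := S in R x N0 \/ exists j, R x (N j))).
- by move=> x J S i _ h; exists i.
- by move=> x N0 a N _; left.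
- by move=> x N0 a N j _ h; right; exists j.
- exact: RV.
- by move=> x F a _; apply: RS.
Qed.

Lemma fv_preE x (S : pre) : fv_pre x S <->
  let: Pre N0 _ N := S in fv_neg x N0 \/ exists j, fv_neg x (N j).
Proof.
split; first by case=> {}x N0 a N => [h|j h]; [left|right; exists j].
by case: S => N0 a N [h|[j h]]; [apply: fv_head|apply: fv_arg h].
Qed.

Lemma fv_posE x (P : pos) : fv_pos x P <-> fv_in (@fv_neg _ _) x P.
Proof.
split=> [[{}x J S i /fv_preE h]|]; first by exists i.
by case: P => // J S [i /fv_preE h]; apply: fv_conj h.
Qed.

Lemma fv_negE x (N : neg) : fv_neg x N ->
  match N with Var y => x = y | Sum F => exists a, fv_pos (ar a + x) (F a) end.
Proof. by case=> // {}x F a h; exists a. Qed.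

Lemma fv_in_impl R1 R2 x y (P : pos) :
  (forall N, R1 x N -> R2 y N) -> fv_in R1 x P -> fv_in R2 y P.
Proof.
move=> h; case: P => // J S [i hi]; exists i; move: hi.
by case: (S i) => N0 a N [/h|[j /h]]; [left|right; exists j].
Qed.

Lemma fv_in_eq R x (P Q : pos) : pos_eq P Q -> fv_in R x P ->
  fv_in (fun x M => exists2 N, R x N & neg_eq N M) x Q.
Proof.
case: P Q => [|J S] [|K T] /pos_eqE //= [h _] [i Ri].
have [k e] := h i; exists k; move: Ri e; case: (S i) => N0 a N.
move=> Ri /pre_eqE [M0 [M [-> e0 e]]].
by case: Ri => [Ri|[j Rj]]; [left; exists N0|right; exists j; exists (N j)].
Qed.

Lemma fv_neg_eq x (N M : neg) : fv_neg x N -> neg_eq N M -> fv_neg x M.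
Proof.
move=> h; elim/fv_neg_in_ind: x N / h M => [x|x F a IH] [y|G] /neg_eqE //.
  by move=> ->; constructor.
move=> e; apply: (@fv_sum _ _ _ _ a); apply/fv_posE.
by apply: fv_in_impl (fv_in_eq (e a) IH) => N [M h]; apply: h.
Qed.

Lemma fv_pos_eq x (P Q : pos) : fv_pos x P -> pos_eq P Q -> fv_pos x Q.
Proof.
move=> /fv_posE h e; apply/fv_posE; apply: fv_in_impl (fv_in_eq e h) => N [M].
exact: fv_neg_eq.
Qed.

Lemma fv_in_ren R y r (P : pos) : fv_in R y (ren_pos r P) ->
  fv_in (fun y N => R y (ren_neg r N)) y P.
Proof.
rewrite ren_posE; case: P => // J S [i h]; exists i; move: h.
by rewrite ren_preE; case: (S i).
Qed.

Lemma fv_in_subst R y s (P : pos) : fv_in R y (subst_pos s P) ->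
  fv_in (fun y N => R y (subst_neg s N)) y P.
Proof.
rewrite subst_posE; case: P => // J S [i h]; exists i; move: h.
by rewrite subst_preE; case: (S i).
Qed.

Lemma fv_in_ex R y (P : pos) (X : nat -> Prop) :
  (forall N, R y N -> exists2 x, fv_neg x N & X x) ->
  fv_in R y P -> exists2 x, fv_pos x P & X x.
Proof.
move=> h; case: P => //= J S [i hi].
suff [x hx Xx] : exists2 x, fv_pre x (S i) & X x.
  by exists x; first apply: fv_conj hx.
case: (S i) hi => N0 a N [/h|[j /h]] [x hx Xx]; exists x => //; apply/fv_preE.
  by left.
by right; exists j.
Qed.

Lemma fv_ren_neg y r (N : neg) :
  fv_neg y (ren_neg r N) -> exists2 x, fv_neg x N & y = r x.
Proof.
(* Designs are coinductive, so the induction is on the derivation of freeness in the renamed design,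
   with [r] and [N] general. *)
move: {2 3}(ren_neg r N) (erefl (ren_neg r N)) => N' E h.
elim/fv_neg_in_ind: y N' / h r N E => [y|y F a IH] r [x|G]; rewrite ren_negE //.
  by case=> <-; exists x => //; constructor.
case=> E; move: IH; rewrite -E => {F E} /fv_in_ren IH.
have [|x hx e] := @fv_in_ex _ _ _ (fun x => ar a + y = up_ren (ar a) r x) _ IH.
  by move=> N; apply.
move: e hx; rewrite /up_ren; case: ltnP => [lt e|le e] hx.
  by move: lt; rewrite -e ltnNge leq_addr.
exists (x - ar a); last by apply/eqP; rewrite -(eqn_add2l (ar a)) e.
by apply: (@fv_sum _ _ _ _ a); rewrite subnKC.
Qed.

Lemma fv_subst_neg y s (N : neg) : fv_neg y (subst_neg s N) ->
  exists2 x, fv_neg x N & fv_neg y (s x).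
Proof.
move: {2 3}(subst_neg s N) (erefl (subst_neg s N)) => N' E h.
(* Freeness in [N'] is carried along for the case where [N] is a variable [x]: there [N'] is [s x]
   itself. *)
have [] // : fv_neg y N' /\ forall s N, subst_neg s N = N' ->
  exists2 x, fv_neg x N & fv_neg y (s x); last by move=> _; apply.
elim/fv_neg_in_ind: y N' / h {s N E} => [y|y F a IH].
  split=> [|s [x|G]]; first by constructor.
    by rewrite subst_negE => E; exists x; [constructor|rewrite E; constructor].
  by rewrite subst_negE.
have hF : fv_pos (ar a + y) (F a).
  by apply/fv_posE; apply: fv_in_impl IH => N [].
split=> [|s [x|G]]; first by apply: fv_sum hF.
  by rewrite subst_negE => E; exists x; [constructor|rewrite E; apply: fv_sum hF].
rewrite subst_negE; case=> E; move: IH; rewrite -E => {F E hF} /fv_in_subst IH.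
have [|x hx] := @fv_in_ex _ _ _ (fun x => fv_neg (ar a + y) (up (ar a) s x)) _ IH.
  by move=> N [_]; apply.
rewrite /up; case: ltnP => [lt /fv_negE e|le].
  by move: lt; rewrite -e ltnNge leq_addr.
move=> /fv_ren_neg [z hz /addnI ->]; exists (x - ar a) => //.
by apply: (@fv_sum _ _ _ _ a); rewrite subnKC.
Qed.

Lemma fv_subst_pos y s (P : pos) : fv_pos y (subst_pos s P) ->
  exists2 x, fv_pos x P & fv_neg y (s x).
Proof. by move=> /fv_posE/fv_in_subst; apply: fv_in_ex => N /fv_subst_neg. Qed.

Lemma fv_reduct y (S : pre) : fv_pos y (reduct S) -> fv_pre y S.
Proof.
case: S => [[x|F] b N] /=; first by move/fv_posE.
move=> /fv_subst_pos [x hx]; rewrite /inst.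
case: insubP => [j _ _ h|]; first by apply/fv_preE; right; exists j.
rewrite -leqNgt => le /fv_negE ->; apply/fv_preE; left.
by apply: (@fv_sum _ _ _ _ b); rewrite subnKC.
Qed.

Lemma fv_conjunct_at y (P : pos) (o : occurrence P) :
  fv_pre y (conjunct_at o) -> fv_pos y P.
Proof.
have h (Q : pos) (i : Defs.index Q) : fv_pre y (conjunct i) -> fv_pos y Q.
  by case: Q i => [[]|J S] i; apply: fv_conj.
by elim: o => {}P i /= => [|o IH /IH /fv_reduct]; apply: h.
Qed.

Lemma fv_in_nf R x y (P : pos) : (forall N, R x (nf_neg N) -> fv_neg y N) ->
  fv_in R x (nf_pos P) -> fv_pos y P.
Proof.
move=> h; rewrite nf_posE; case: (pselect _) => // _ [[o ho]] /= Ro.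
apply: (@fv_conjunct_at _ _ o); apply/fv_preE.
case: (conjunct_at o) ho Ro => [[z|//] a N] _ [Rz|[j /h]]; last by right; exists j.
by left; apply: h; rewrite nf_negE.
Qed.

Lemma fv_nf_neg y (N : neg) : fv_neg y (nf_neg N) -> fv_neg y N.
Proof.
move: {2 3}(nf_neg N) (erefl (nf_neg N)) => N' E h.
elim/fv_neg_in_ind: y N' / h N E => [y|y F a IH] [x|G]; rewrite nf_negE //.
  by case=> ->; constructor.
case=> E; move: IH; rewrite -E => {F E} IH; apply: (@fv_sum _ _ _ _ a).
by apply: fv_in_nf IH => N; apply.
Qed.

Lemma fv_nf_pos y (P : pos) : fv_pos y (nf_pos P) -> fv_pos y P.
Proof. by move=> /fv_posE; apply: fv_in_nf => N /fv_nf_neg. Qed.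

(** * Normal forms are cut-free, and identity-free if the design is *)

Lemma id_free_ren_pos r (P : pos) : id_free_pos P -> id_free_pos (ren_pos r P)
with id_free_ren_pre r (S : pre) : id_free_pre S -> id_free_pre (ren_pre r S)
with id_free_ren_neg r (N : neg) : id_free_neg N -> id_free_neg (ren_neg r N).
Proof.
- rewrite ren_posE; case: P => [|J S] /id_free_posE h; constructor=> i.
  exact: id_free_ren_pre.
- rewrite ren_preE; case: S => N0 a N /id_free_preE [h0 h].
  case: N0 h0 => [x|F] h0.
    by rewrite (ren_negE r (Var _ x)); apply: if_head=> j; apply: id_free_ren_neg.
  by apply: if_cut=> [|j]; apply: id_free_ren_neg.
- rewrite ren_negE; case: N => [x /id_free_negE //|F /id_free_negE h].
  by constructor=> a; apply: id_free_ren_pos.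
Qed.

Lemma id_free_up m s : (forall x, id_free_head (s x)) ->
  forall x, id_free_head (up m s x).
Proof.
move=> h x; rewrite /up; case: ltnP => // _; move: (h (x - m)).
case: (s _) => [y|F]; first by rewrite ren_negE.
by move=> /(@id_free_ren_neg (addn m)); rewrite ren_negE.
Qed.

(** An identity-free design has bare variables only in head position, so a value [s x] lands only
    there and may itself be a variable. *)
Lemma id_free_subst_pos s (P : pos) : (forall x, id_free_head (s x)) ->
  id_free_pos P -> id_free_pos (subst_pos s P)
with id_free_subst_pre s (S : pre) : (forall x, id_free_head (s x)) ->
  id_free_pre S -> id_free_pre (subst_pre s S)
with id_free_subst_neg s (N : neg) : (forall x, id_free_head (s x)) ->
  id_free_neg N -> id_free_neg (subst_neg s N).
Proof.
- move=> hs; rewrite subst_posE; case: P => [|J S] /id_free_posE h; constructor=> i.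
  exact: id_free_subst_pre.
- move=> hs; rewrite subst_preE; case: S => N0 a N /id_free_preE [h0 h].
  case: N0 h0 => [x|F] h0.
    rewrite (subst_negE s (Var _ x)); move: (hs x); case: (s x) => [y|F] hF.
      by apply: if_head=> j; apply: id_free_subst_neg.
    by apply: if_cut=> [//|j]; apply: id_free_subst_neg.
  by apply: if_cut=> [|j]; apply: id_free_subst_neg.
- move=> hs; rewrite subst_negE; case: N => [x /id_free_negE //|F /id_free_negE h].
  by constructor=> a; apply: id_free_subst_pos => //; apply: id_free_up.
Qed.

Lemma id_free_reduct (S : pre) : id_free_pre S -> id_free_pos (reduct S).
Proof.
case: S => [[x|F] b N] /id_free_preE [h0 hN] /=; first by constructor.
apply: id_free_subst_pos; last by move/id_free_negE: h0.
by move=> x; rewrite /inst; case: insub => // j; case: (N j) (hN j).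
Qed.

Lemma id_free_conjunct_at (P : pos) (o : occurrence P) :
  id_free_pos P -> id_free_pre (conjunct_at o).
Proof.
have h (Q : pos) (i : Defs.index Q) : id_free_pos Q -> id_free_pre (conjunct i).
  by case: Q i => [[]|J S] i /id_free_posE.
by elim: o => {}P i /= => [|o IH /(h _ i)/id_free_reduct/IH]; first exact: h.
Qed.

Lemma id_free_nf_pos (P : pos) : id_free_pos P -> id_free_pos (nf_pos P)
with id_free_nf_neg (N : neg) : id_free_neg N -> id_free_neg (nf_neg N).
Proof.
- rewrite nf_posE; case: pselect => [d|nd] h; first by constructor.
  constructor=> -[o ho] /=.
  move: ho (id_free_conjunct_at o h).
  case: (conjunct_at o) => [[x|F] a N] //= _ /id_free_preE [_ hN].
  by apply: if_head=> j; apply: id_free_nf_neg.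
- rewrite nf_negE; case: N => [x /id_free_negE //|F /id_free_negE h].
  by constructor=> a; apply: id_free_nf_pos.
Qed.

Lemma cut_free_nf_pos (P : pos) : cut_free_pos (nf_pos P)
with cut_free_nf_neg (N : neg) : cut_free_neg (nf_neg N).
Proof.
- rewrite nf_posE; case: pselect => [d|nd]; first by constructor.
  constructor=> -[o] /=.
  case: (conjunct_at o) => [[x|//] a N] _.
  by constructor=> j; exact: cut_free_nf_neg.
- rewrite nf_negE; case: N => [x|F]; first by constructor.
  by constructor=> a; exact: cut_free_nf_pos.
Qed.

(** * The environment machine and its bisimulation *)

(** [Stuck] is the value of a free variable. Closures are well-founded although their bodies may be
    infinite, so induction on them is available. *)
Inductive clo : Type :=
| Stuck
| Clo (F : A -> pos) (e : nat -> clo).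

Definition eval (N : neg) (e : nat -> clo) : clo :=
  match N with Var x => e x | Sum F => Clo F e end.

Definition binds m (f : 'I_m -> clo) (e : nat -> clo) (x : nat) : clo :=
  if insub x is Some j then f j else e (x - m).

(** A stuck head leads to [Omega], on which [run] fails. *)
Definition app (c : clo) b (f : 'I_(ar b) -> clo) : pos * (nat -> clo) :=
  match c with
  | Stuck => (Omega _, fun=> Stuck)
  | Clo F e => (F b, binds f e)
  end.

Definition step (S : pre) (e : nat -> clo) : pos * (nat -> clo) :=
  let: Pre N0 b N := S in app (eval N0 e) (fun j => eval (N j) e).

(** Inductiveness rules out infinite executions; the base case is the empty conjunction. *)
Inductive run : pos * (nat -> clo) -> Prop :=
| Run J (S : J -> pre) e : (forall i, run (step (S i) e)) -> run (Conj S, e).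

Lemma runE s : run s ->
  if s.1 is Conj _ T then forall i, run (step (T i) s.2) else False.
Proof. by case. Qed.

(** The congruence generated by identifying performed substitutions and renamings with delayed ones.
    [ceq_eq] compares environments only on free variables, so a closed design may change
    environment, see [ceq_closed]. *)
Inductive ceq : clo -> clo -> Prop :=
| ceq_refl c : ceq c c
| ceq_sym c d : ceq c d -> ceq d c
| ceq_trans c d e : ceq c d -> ceq d e -> ceq c e
| ceq_eq F G e e' : (forall a, pos_eq (F a) (G a)) ->
    (forall x, fv_neg x (Sum F) -> ceq (e x) (e' x)) -> ceq (Clo F e) (Clo G e')
| ceq_subst F s e e' : (forall x, ceq (eval (s x) e) (e' x)) ->
    ceq (Clo (fun a => subst_pos (up (ar a) s) (F a)) e) (Clo F e')
| ceq_ren F r e e' : (forall x, ceq (e (r x)) (e' x)) ->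
    ceq (Clo (fun a => ren_pos (up_ren (ar a) r) (F a)) e) (Clo F e').

(* Substitutions and renamings of the term may be moved to the environment. *)
Inductive steq : pos * (nat -> clo) -> pos * (nat -> clo) -> Prop :=
| steq_sym s t : steq s t -> steq t s
| steq_trans s t u : steq s t -> steq t u -> steq s u
| steq_eq P Q e e' : pos_eq P Q ->
    (forall x, fv_pos x P -> ceq (e x) (e' x)) -> steq (P, e) (Q, e')
| steq_subst P s e e' : (forall x, ceq (eval (s x) e) (e' x)) ->
    steq (subst_pos s P, e) (P, e')
| steq_ren P r e e' : (forall x, ceq (e (r x)) (e' x)) ->
    steq (ren_pos r P, e) (P, e').

Lemma ceq_eval_eq N M e e' : neg_eq N M ->
  (forall x, fv_neg x N -> ceq (e x) (e' x)) -> ceq (eval N e) (eval M e').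
Proof.
case: N M => [x|F] [y|G] /neg_eqE //= h he; last exact: ceq_eq.
by rewrite -h; apply: he; constructor.
Qed.

Lemma ceq_eval N e e' : (forall x, ceq (e x) (e' x)) -> ceq (eval N e) (eval N e').
Proof. by move=> h; apply: ceq_eval_eq => [|x _]; [apply: neg_eq_refl|]. Qed.

Lemma ceq_eval_subst N s e e' : (forall x, ceq (eval (s x) e) (e' x)) ->
  ceq (eval (subst_neg s N) e) (eval N e').
Proof.
by move=> h; rewrite subst_negE; case: N => [x|F]; [apply: h|apply: ceq_subst].
Qed.

Lemma ceq_eval_ren N r e e' : (forall x, ceq (e (r x)) (e' x)) ->
  ceq (eval (ren_neg r N) e) (eval N e').
Proof.
by move=> h; rewrite ren_negE; case: N => [x|F]; [apply: h|apply: ceq_ren].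
Qed.

Lemma binds_lt m (f : 'I_m -> clo) e x (lt : x < m) : binds f e x = f (Ordinal lt).
Proof. by rewrite /binds insubT. Qed.

Lemma binds_ge m (f : 'I_m -> clo) e x : m <= x -> binds f e x = e (x - m).
Proof. by rewrite leqNgt => le; rewrite /binds insubF //; apply: negbTE. Qed.

(** The shift by [m] in [up] cancels against the [m] entries that [binds] puts in front. *)
Lemma ceq_binds_up m (f g : 'I_m -> clo) s e e' :
  (forall j, ceq (f j) (g j)) -> (forall x, ceq (eval (s x) e) (e' x)) ->
  forall x, ceq (eval (up m s x) (binds f e)) (binds g e' x).
Proof.
move=> hf h x; rewrite /up; case: ltnP => [lt|le].
  by rewrite /= !binds_lt.
rewrite (binds_ge _ _ le); apply: ceq_trans (h _); apply: ceq_eval_ren => y.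
by rewrite binds_ge ?leq_addr // addKn; apply: ceq_refl.
Qed.

Lemma ceq_binds_up_ren m (f g : 'I_m -> clo) r e e' :
  (forall j, ceq (f j) (g j)) -> (forall x, ceq (e (r x)) (e' x)) ->
  forall x, ceq (binds f e (up_ren m r x)) (binds g e' x).
Proof.
move=> hf h x; rewrite /up_ren; case: ltnP => [lt|le].
  by rewrite !binds_lt.
by rewrite !binds_ge ?leq_addr // addKn.
Qed.

Lemma steq_refl s : steq s s.
Proof. by case: s => P e; apply: steq_eq (pos_eq_refl P) _ => x _; apply: ceq_refl. Qed.

(** Induction on [ceq]: entering the bodies turns each of its rules into the corresponding one of
    [steq]. *)
Lemma steq_app c d b (f g : 'I_(ar b) -> clo) : ceq c d ->
  (forall j, ceq (f j) (g j)) -> steq (app c f) (app d g).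
Proof.
have binds_eq P (e e' : nat -> clo) (f' g' : 'I_(ar b) -> clo) :
  (forall j, ceq (f' j) (g' j)) ->
  (forall x, fv_pos (ar b + x) P -> ceq (e x) (e' x)) ->
  forall x, fv_pos x P -> ceq (binds f' e x) (binds g' e' x).
  move=> hf h x; case: (ltnP x (ar b)) => [lt|le]; first by rewrite !binds_lt.
  by rewrite !binds_ge // => hx; apply: h; rewrite subnKC.
move=> h; elim: h f g => {c d}.
- case=> [|F e] f g hf /=; first exact: steq_refl.
  apply: steq_eq (pos_eq_refl _) _.
  by apply: binds_eq hf _ => x _; apply: ceq_refl.
- move=> c d _ IH f g hf; apply: steq_sym; apply: IH => j.
  exact: ceq_sym.
- move=> c d e _ IH1 _ IH2 f g hf; apply: steq_trans (IH1 _ _ hf) (IH2 _ _ _) => j.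
  exact: ceq_refl.
- move=> F G e e' hF he _ f g hf; apply: steq_eq => //.
  by apply: binds_eq hf _ => x hx; apply: he; apply: fv_sum hx.
- by move=> F s e e' he _ f g hf; apply: steq_subst; apply: ceq_binds_up.
- by move=> F r e e' he _ f g hf; apply: steq_ren; apply: ceq_binds_up_ren.
Qed.

(** The one-step clause of bisimilarity. *)
Definition steq_step (s t : pos * (nat -> clo)) : Prop :=
  match s.1, t.1 with
  | Omega, Omega => True
  | Conj _ U, Conj _ T =>
    (forall i, exists j, steq (step (U i) s.2) (step (T j) t.2)) /\
    (forall j, exists i, steq (step (U i) s.2) (step (T j) t.2))
  | _, _ => False
  end.

(** In the three generating cases heads and arguments evaluate to [ceq] closures, and [steq_app]
    concludes. *)
Lemma steqE s t : steq s t -> steq_step s t.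
Proof.
rewrite /steq_step; elim=> {s t}.
- move=> [P e] [Q e'] /= _; case: P Q => [|J S] [|K T] //= [h1 h2].
  split=> i; [have [j h] := h2 i|have [j h] := h1 i].
    by exists j; apply: steq_sym.
  by exists j; apply: steq_sym.
- move=> [P e] [Q e'] [R e''] /= _ h _; case: P Q R h => [|J S] [|K T] [|L U] //=.
  move=> [h1 h2] [h3 h4]; split=> i.
    have [j hj] := h1 i; have [k hk] := h3 j; exists k; exact: steq_trans hj hk.
  have [j hj] := h4 i; have [k hk] := h2 j; exists k; exact: steq_trans hk hj.
- move=> P Q e e' /pos_eqE; case: P Q => [|J S] [|K T] //= [h1 h2] he.
  have h i j : pre_eq (S i) (T j) -> steq (step (S i) e) (step (T j) e').
    have {}he x : fv_pre x (S i) -> ceq (e x) (e' x).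
      by move=> hx; apply: he; apply: fv_conj hx.
    case: (S i) he => N0 a N he /pre_eqE [M0 [M [-> e0 eN]]] /=.
    apply: steq_app => [|k]; apply: ceq_eval_eq => // x hx; apply: he.
      exact: fv_head.
    exact: fv_arg hx.
  by split=> i; [have [j /h] := h1 i|have [j /h] := h2 i]; exists j.
- move=> P s e e' he; rewrite subst_posE; case: P => //= J S.
  have h i : steq (step (subst_pre s (S i)) e) (step (S i) e').
    rewrite subst_preE; case: (S i) => N0 a N /=.
    by apply: steq_app => [|k]; apply: ceq_eval_subst.
  by split=> i; exists i; apply: h.
- move=> P s e e' he; rewrite ren_posE; case: P => //= J S.
  have h i : steq (step (ren_pre s (S i)) e) (step (S i) e').
    rewrite ren_preE; case: (S i) => N0 a N /=.
    by apply: steq_app => [|k]; apply: ceq_eval_ren.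
  by split=> i; exists i; apply: h.
Qed.

Lemma run_steq s t : steq s t -> run s -> run t.
Proof.
move=> h r; elim: r t h => {s} J S e _ IH [Q e'] /steqE; rewrite /steq_step /=.
case: Q => // K T [_ h]; constructor=> j.
by have [i /IH] := h j.
Qed.

Lemma run_subst s P e : run (subst_pos s P, e) <-> run (P, fun x => eval (s x) e).
Proof.
have h : steq (subst_pos s P, e) (P, fun x => eval (s x) e).
  by apply: steq_subst => x; apply: ceq_refl.
by split; apply: run_steq => //; apply: steq_sym.
Qed.

Lemma run_ceq P e e' : (forall x, fv_pos x P -> ceq (e x) (e' x)) ->
  run (P, e) -> run (P, e').
Proof. by move=> h; apply: run_steq; apply: steq_eq (pos_eq_refl P) h. Qed.

(** Links the machine to reduction of terms: [inst N], read in [e], is the environment built by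
    [binds]. *)
Lemma steq_reduct (S : pre) e : ~~ head_var S -> steq (step S e) (reduct S, e).
Proof.
case: S => [[//|F] b N] _ /=; apply: steq_sym; apply: steq_subst => x.
rewrite /inst /binds; case: insubP => [j _ _|_]; exact: ceq_refl.
Qed.

(** * Divergence as failure of well-foundedness *)

(* The well-foundedness form of the negation of [diverges], see [divergesE]. *)
Inductive wfp : pos -> Prop :=
| Wfp J (S : J -> pre) :
    (forall i, ~~ head_var (S i) -> wfp (reduct (S i))) -> wfp (Conj S).

Lemma redE (P Q : pos) : red P Q -> if P is Conj _ T then
  exists2 i, ~~ head_var (T i) & reduct (T i) = Q else False.
Proof. by case=> J S i F b N E; exists i; rewrite E. Qed.

Lemma not_wfp (P : pos) : ~ wfp P -> P = Omega _ \/ exists2 Q, red P Q & ~ wfp Q.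
Proof.
case: P => [|J S] h; [by left|right]; apply: contrapT => no.
apply: h; constructor=> i hi; apply: contrapT => h; apply: no.
exists (reduct (S i)) => //; case E: (S i) hi h => [[x|F] b N] //= _ _.
exact: Red E.
Qed.

Lemma redsE (P R : pos) : reds P R -> P = R \/ exists2 Q, red P Q & reds Q R.
Proof.
move=> /clos_rt_rt1n_iff [|Q {}R PQ QR]; first by left.
by right; exists Q => //; apply/clos_rt_rt1n_iff.
Qed.

Lemma divergesE (P : pos) : diverges P <-> ~ wfp P.
Proof.
split=> [d w|h].
  elim: w d => {P} J S _ IH [[s [s0 sr]]|r].
    have := sr 0; rewrite s0 => /redE [i hi Es].
    by apply: (IH i hi); left; exists (fun n => s n.+1); split.
  have [//|[Q /redE [i hi <-] QO]] := redsE r.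
  by apply: (IH i hi); right.
case: (pselect (reds P (Omega _))) => [r|nr]; first by right.
left.
(* As [Omega] is not reachable, each non-well-founded reduct has a non-well-founded successor;
   iterating a choice of it gives an infinite reduction. *)
have next (Q : {Q | reds P Q /\ ~ wfp Q}) :
    {R : {Q | reds P Q /\ ~ wfp Q} | red (sval Q) (sval R)}.
  case: Q => Q [rQ wQ]; apply: cid => /=.
  have [E|[R QR wR]] := not_wfp wQ; first by rewrite E in rQ.
  by exists (exist _ R (conj (rt_trans _ _ _ _ _ rQ (rt_step _ _ _ _ QR)) wR)).
pose s0 : {Q | reds P Q /\ ~ wfp Q} := exist _ P (conj (rt_refl _ _ _) h).
exists (fun n => sval (iter n (fun Q => sval (next Q)) s0)); split=> // n.
exact: (svalP (next _)).
Qed.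

(** * Invariance of [run] under normalization *)

(* Some bodies in the left closure are normalized in the right one. *)
Inductive nceq : clo -> clo -> Prop :=
| nceq_Stuck : nceq Stuck Stuck
| nceq_Clo F G e e' : (forall a, G a = F a \/ G a = nf_pos (F a)) ->
    (forall x, nceq (e x) (e' x)) -> nceq (Clo F e) (Clo G e').

Definition nst (s t : pos * (nat -> clo)) : Prop :=
  (t.1 = s.1 \/ t.1 = nf_pos s.1) /\ forall x, nceq (s.2 x) (t.2 x).

Lemma nceq_refl c : nceq c c.
Proof. by elim: c => [|F e IH]; constructor=> // a; left. Qed.

Lemma nceq_eval N e e' : (forall x, nceq (e x) (e' x)) ->
  nceq (eval N e) (eval N e').
Proof. by case: N => [x|F] h //=; constructor=> // a; left. Qed.

Lemma nceq_eval_nf N e e' : (forall x, nceq (e x) (e' x)) ->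
  nceq (eval N e) (eval (nf_neg N) e').
Proof. by rewrite nf_negE; case: N => [x|F] h //=; constructor=> // a; right. Qed.

Lemma nst_app c d b (f g : 'I_(ar b) -> clo) : nceq c d ->
  (forall j, nceq (f j) (g j)) -> nst (app c f) (app d g).
Proof.
case=> [|F G e e' h he] hf; split=> //=; first by left.
  by move=> x; apply: nceq_refl.
by move=> x; rewrite /binds; case: insub.
Qed.

Lemma nst_step S e e' : (forall x, nceq (e x) (e' x)) ->
  nst (step S e) (step S e').
Proof. by move=> h; case: S => N0 a N; apply: nst_app => [|j]; apply: nceq_eval. Qed.

Lemma nst_step_nf S e e' : (forall x, nceq (e x) (e' x)) ->
  nst (step S e) (step (nf_pre S) e').
Proof.
move=> h; case: S => N0 a N; apply: nst_app => [|j]; first exact: nceq_eval.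
exact: nceq_eval_nf.
Qed.

Lemma nf_Conj (P : pos) : wfp P -> nf_pos P =
  Conj (fun o : {o : occurrence P | head_var (conjunct_at o)} =>
    nf_pre (conjunct_at (sval o))).
Proof. by rewrite nf_posE; case: pselect => //= /divergesE. Qed.

Lemma run_nf (P : pos) e : run (nf_pos P, e) <->
  wfp P /\ forall o : occurrence P, head_var (conjunct_at o) ->
    run (step (nf_pre (conjunct_at o)) e).
Proof.
split=> [/runE|[w h]]; last by rewrite nf_Conj //; constructor=> -[o ho]; apply: h.
rewrite nf_posE; case: pselect => //= d h.
split=> [|o ho]; last exact: (h (exist _ o ho)).
by apply: contrapT => /divergesE.
Qed.

(** A non-cut has reduct [Omega], in which nothing occurs. *)
Lemma occurrence_reduct (S : pre) : occurrence (reduct S) -> ~~ head_var S.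
Proof. by case: S => [[x|//] b N] /= [[]|[]]. Qed.

(* The intermediate [t] is there because the reducts of [s] as terms, which index
   the conjuncts of its normal form, are only [steq] to its machine steps. *)
Lemma run_nst s t u : run s -> steq s t -> nst t u -> run u.
Proof.
move=> r; elim: r t u => {s} J S e _ IH [P e'] [Q e''] /steqE.
rewrite /steq_step /nst /=; case: P => // K T [_ h] [[->|->] he].
  by constructor=> j; have [i hi] := h j; apply: IH hi _; apply: nst_step.
(* By [run_nf], this yields both the well-foundedness of the reducts and the runs from their
   conjuncts, that is, from the deeper occurrences. *)
have hnf j : ~~ head_var (T j) -> run (nf_pos (reduct (T j)), e'').
  move=> hj; have [i hi] := h j; apply: IH (steq_trans hi (steq_reduct _ hj)) _.
  by split=> //=; right.
apply/run_nf; split; first by constructor=> j /hnf /run_nf [].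
move=> o; case: o => [j|j o] /= hv.
  by have [i hi] := h j; apply: IH hi _; apply: nst_step_nf.
by have /run_nf [_] := hnf j (occurrence_reduct o); apply.
Qed.

(** Outer induction on the run of [t]. One step of a normal form may stand for many steps in [s]; an
    inner induction on [wfp] replays the cuts down to head variables. *)
Lemma run_nst_inv s t : run t -> nst s t -> run s.
Proof.
move=> r; elim: r s => {t} J S e' _ IH [P e].
(* The induction hypothesis for an arbitrary [Q], so that [Conj S] can be replaced by [nf_pos P]
   without dependent equations. *)
pose R Q := if Q is Conj _ T then
  forall i s, nst s (step (T i) e') -> run s else False.
have {IH} : R (Conj S) := IH.
move: (Conj S) => {J S} Q C [/= EQ he].
case: EQ C => [->|->] C.
  by case: P C => // J S C; constructor=> i; apply: C; apply: nst_step.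
have {C} [w C] : wfp P /\ forall o : occurrence P, head_var (conjunct_at o) ->
    run (step (conjunct_at o) e).
  move: C; rewrite /R nf_posE; case: pselect => //= d C; split.
    by apply: contrapT => /divergesE.
  by move=> o ho; apply: (C (exist _ o ho)); apply: nst_step_nf.
elim: w C => {P} J S _ IH C; constructor=> i.
case: (boolP (head_var (S i))) => [hi|hi]; first exact: (C (@Here _ _ (Conj S) i)).
apply: run_steq (steq_sym (steq_reduct e hi)) _; apply: IH => // o ho.
exact: (C (@There _ _ (Conj S) i o)).
Qed.

Lemma run_nf_pos P e : run (nf_pos P, e) <-> run (P, e).
Proof.
have h : nst (P, e) (nf_pos P, e) by split=> [|x]; [right|apply: nceq_refl].
split=> [r|r]; first exact: run_nst_inv r h.
exact: run_nst r (steq_refl _) h.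
Qed.

Lemma run_nceq P e e' : (forall x, nceq (e x) (e' x)) ->
  run (P, e) <-> run (P, e').
Proof.
move=> he; have h : nst (P, e) (P, e') by split=> //=; left.
split=> r; last exact: run_nst_inv r h.
exact: run_nst r (steq_refl _) h.
Qed.

(** All heads of a normal form are variables, which are stuck here, so it runs exactly when it is an
    empty conjunction. *)
Lemma nf_daimon P : pos_eq (nf_pos P) (daimon ar) <-> run (P, fun=> Stuck).
Proof.
rewrite -run_nf_pos; split=> [/pos_eqE|].
  by case: (nf_pos P) => // J S [h _]; constructor=> i; have [[]] := h i.
move=> /run_nf [w h]; rewrite nf_Conj //; constructor=> [[o ho]|[]].
by move: (h o ho); case: (conjunct_at o) ho => [[x|//] a N] _ /runE.
Qed.

(** * Orthogonality and contexts on the machine *)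

Definition at0 (c : clo) (x : nat) : clo := if x == x0 then c else Stuck.

Definition genv (G : ctx ar) (K : nat -> neg) (x : nat) : clo :=
  if G x is Some _ then eval (K x) (fun=> Stuck) else Stuck.

Definition close (G : ctx ar) (K : nat -> neg) (N : neg) : neg :=
  nf_neg (subst_neg (ctx_sub G K) N).

Lemma run_ceqE P e e' : (forall x, ceq (e x) (e' x)) ->
  run (P, e) <-> run (P, e').
Proof. by move=> h; split; apply: run_ceq => x _; [apply: h|apply: ceq_sym]. Qed.

(** The order, [ceq] before [nceq], is that of [close]: substitution, then normalization. *)
Definition cneq c d := exists2 c', ceq c c' & nceq c' d.

Lemma cneq_ceq c d : ceq c d -> cneq c d.
Proof. by move=> h; exists d => //; apply: nceq_refl. Qed.

Lemma cneq_choice (e e' : nat -> clo) : (forall x, cneq (e x) (e' x)) ->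
  exists2 f, forall x, ceq (e x) (f x) & forall x, nceq (f x) (e' x).
Proof.
move=> h; have /choice [f hf] x : exists c, ceq (e x) c /\ nceq c (e' x).
  by have [c] := h x; exists c.
by exists f => x; have [] := hf x.
Qed.

Lemma cneq_eval N e e' : (forall x, cneq (e x) (e' x)) -> cneq (eval N e) (eval N e').
Proof.
move=> /cneq_choice [f h1 h2]; exists (eval N f); first exact: ceq_eval.
exact: nceq_eval.
Qed.

Lemma cneq_trans_ceq c d e : ceq c d -> cneq d e -> cneq c e.
Proof. by move=> h [d' hd ?]; exists d' => //; apply: ceq_trans hd. Qed.

Lemma run_cneq P e e' : (forall x, cneq (e x) (e' x)) ->
  run (P, e) <-> run (P, e').
Proof.
move=> /cneq_choice [f h1 h2]; apply: (iff_trans (B := run (P, f))).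
  exact: run_ceqE.
exact: run_nceq.
Qed.

Lemma ceq_ctx_sub G K x : ceq (eval (ctx_sub G K x) (fun=> Stuck)) (genv G K x).
Proof. by rewrite /ctx_sub /genv; case: (G x) => [P|]; apply: ceq_refl. Qed.

Lemma ceq_sub1 N x :
  ceq (eval (sub1 x0 N x) (fun=> Stuck)) (at0 (eval N (fun=> Stuck)) x).
Proof. by rewrite /sub1 /at0; case: eqP => _; apply: ceq_refl. Qed.

Lemma orthogonalE P N : orthogonal P N <-> run (P, at0 (eval N (fun=> Stuck))).
Proof.
rewrite /orthogonal nf_daimon run_subst; apply: run_ceqE => x; exact: ceq_sub1.
Qed.

Lemma run_pos_ctx P G K :
  pos_eq (nf_pos (subst_pos (ctx_sub G K) P)) (daimon ar) <-> run (P, genv G K).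
Proof. rewrite nf_daimon run_subst; apply: run_ceqE => x; exact: ceq_ctx_sub. Qed.

Lemma ceq_at0 c d x : ceq c d -> ceq (at0 c x) (at0 d x).
Proof. by rewrite /at0; case: eqP => // _ _; apply: ceq_refl. Qed.

Lemma cneq_at0 c d x : cneq c d -> cneq (at0 c x) (at0 d x).
Proof. by rewrite /at0; case: eqP => // _ _; apply: cneq_ceq; apply: ceq_refl. Qed.

Lemma run_neg_ctx Q N G K :
  pos_eq (nf_pos (subst_pos (sub1 x0 (subst_neg (ctx_sub G K) N)) Q)) (daimon ar)
  <-> run (Q, at0 (eval N (genv G K))).
Proof.
apply: (iff_trans (orthogonalE _ _)); apply: run_ceqE => x; apply: ceq_at0.
by apply: ceq_eval_subst => y; apply: ceq_ctx_sub.
Qed.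

Lemma cneq_close G K N :
  cneq (eval N (genv G K)) (eval (close G K N) (fun=> Stuck)).
Proof.
exists (eval (subst_neg (ctx_sub G K) N) (fun=> Stuck)).
  apply: ceq_sym; apply: ceq_eval_subst => x; exact: ceq_ctx_sub.
by apply: nceq_eval_nf => x; apply: nceq_refl.
Qed.

Lemma ceq_closed N e e' : atomic_neg N -> ceq (eval N e) (eval N e').
Proof.
move=> [_ fN]; apply: ceq_eval_eq (neg_eq_refl N) _ => x hx.
by have : fv (DNeg N) x by []; rewrite fN.
Qed.

Lemma run_single S e : run (single S, e) <-> run (step S e).
Proof. by split=> [/runE /(_ tt)|h]; last constructor. Qed.

(** * Atomicity of closed premises and of generators *)

(** The substituted counter-designs are closed and identity-free, and normalization creates neither
    free variables nor identities. *)
Lemma atomic_close G K N : ctx_orth G K -> id_free_neg N ->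
  fv (DNeg N) `<=` dom G -> atomic_neg (close G K N).
Proof.
move=> oK iN fN; split.
  split=> //; first exact: cut_free_nf_neg.
  apply: id_free_nf_neg; apply: id_free_subst_neg => // x.
  rewrite /ctx_sub; case E: (G x) => [P|] //.
  by have [[[_ _ /=]]] := oK x P E; case: (K x).
apply/seteqP; split=> // y /fv_nf_neg /fv_subst_neg [x /fN /=].
rewrite /dom /ctx_sub /=; case E: (G x) => [P|] // _ hy.
by have [[_ fK] _] := oK x P E; have : fv (DNeg (K x)) y by []; rewrite fK.
Qed.

(** The generators whose biorthogonal is [conn_pos]. *)
Definition actions n (alpha : connective ar n) (X : 'I_n -> set neg) : set pos :=
  [set P | exists a v, act alpha a = Some v /\ action_pos (fun j => X (v j)) P].

Lemma atomic_actions n (alpha : connective ar n) (X : 'I_n -> set neg) :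
  (forall i, X i `<=` @atomic_neg _ ar) -> actions alpha X `<=` @atomic_pos _ ar.
Proof.
move=> hX P [a [v [_ [N XN e]]]]; have aN j : atomic_neg (N j) := hX _ _ (XN j).
have e' := pos_eq_sym e.
have sN j : standard (DNeg (N j)) by have [] := aN j.
split; first split.
- by move=> [EP]; move: e; rewrite EP => /pos_eqE.
- apply: cut_free_pos_eq e' _; constructor=> _; constructor=> j.
  by have [] := sN j.
- apply: id_free_pos_eq e' _; constructor=> _; apply: if_head => j.
  by have [] := sN j.
- move=> y /= /fv_pos_eq /(_ e) /fv_posE /= [_ [/fv_negE //|[j hj]]].
  by have [_ fN] := aN j; have : fv (DNeg (N j)) y by []; rewrite fN.
Qed.

Lemma logical_pos_atomic X : logical_pos X -> X `<=` @atomic_pos _ ar.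
Proof. by case/logical_pos_behaviour. Qed.

Lemma logical_neg_atomic X : logical_neg X -> X `<=` @atomic_neg _ ar.
Proof. by case/logical_neg_behaviour. Qed.

Lemma neg_orth_pos_orth X : X `<=` @atomic_pos _ ar -> X `<=` neg_orth (pos_orth X).
Proof. by move=> aX P XP; split; [apply: aX|move=> N [_]; apply]. Qed.

(** * Soundness of the rules *)

(** The orthogonality clause of [models] on the machine, for [D] itself instead of its normal
    form. *)
Definition sem (D : design ar) (G : ctx ar) (Xi : option (set neg)) : Prop :=
  match D, Xi with
  | DPos P, None => forall K, ctx_orth G K -> run (P, genv G K)
  | DNeg N, Some X => forall K Q, ctx_orth G K -> neg_orth X Q ->
      run (Q, at0 (eval N (genv G K)))
  | _, _ => False
  end.

(** The invariant of the induction on derivations: the first two fields make closed premises atomic,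
    and [sound_ctx] lets orthogonals cancel. *)
Record sound (D : design ar) (G : ctx ar) (Xi : option (set neg)) : Prop := {
  sound_id_free : id_free D;
  sound_fv : fv D `<=` dom G;
  sound_ctx : forall x P, G x = Some P -> P `<=` @atomic_pos _ ar;
  sound_sem : sem D G Xi }.

Lemma sequent_sound D G Xi : sequent D G Xi -> sem D G Xi -> sound D G Xi.
Proof.
case=> _ [_ iD _] _ hG _ fD h; split=> // x P /hG; exact: logical_pos_atomic.
Qed.

Lemma sound_eq D E G Xi : design_eq D E -> sound D G Xi -> sound E G Xi.
Proof.
case: D E => [P|N] [Q|M] //= e [iD fD hG h]; split=> //.
- exact: id_free_pos_eq e iD.
- by move=> x /= /fv_pos_eq /(_ (pos_eq_sym e)) /fD.
- case: Xi h => //= h K /h; apply: run_steq; apply: steq_eq => // x _; exact: ceq_refl.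
- exact: id_free_neg_eq e iD.
- by move=> x /= /fv_neg_eq /(_ (neg_eq_sym e)) /fD.
- case: Xi h => //= X h K Q oK XQ; apply: run_ceq (h _ _ oK XQ) => x _.
  apply: ceq_at0; apply: ceq_eval_eq => // y _; exact: ceq_refl.
Qed.

(** The form in which negative premises are used; for a behaviour the biorthogonal is [X] itself. *)
Lemma sound_close N G X K : sound (DNeg N) G (Some X) -> ctx_orth G K ->
  pos_orth (neg_orth X) (close G K N).
Proof.
move=> [iN fN _ h] oK; split; first exact: atomic_close.
move=> Q XQ; apply/orthogonalE.
by apply/(run_cneq _ (fun x => cneq_at0 x (cneq_close G K N))); apply: h.
Qed.

(** Closing the arguments gives a generator of [conn_pos alpha X], which runs against the value of
    [z]; by [cneq_close] the original arguments may replace the closed ones. *)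
Lemma sem_pos_rule G z n (alpha : connective ar n) (X : 'I_n -> set neg)
    a (v : 'I_(ar a) -> 'I_n) (M : 'I_(ar a) -> neg) :
  (forall i, logical_neg (X i)) ->
  G z = Some (conn_pos alpha X) -> act alpha a = Some v ->
  (forall j, sound (DNeg (M j)) G (Some (X (v j)))) ->
  sem (DPos (single (Pre (Var _ z) M))) G None.
Proof.
move=> lX Gz Ea hM K oK; pose M' j := close G K (M j).
have XM j : X (v j) (M' j).
  by have [_ <-] := logical_neg_behaviour (lX (v j)); apply: sound_close.
have aX i : X i `<=` @atomic_neg _ ar by apply: logical_neg_atomic.
have [_ oz] := oK z _ Gz.
have /oz /orthogonalE /run_single r : conn_pos alpha X (single (Pre (Var _ x0) M')).
  apply: neg_orth_pos_orth; first exact: atomic_actions.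
  by exists a, v; split=> //; exists M' => //; apply: pos_eq_refl.
apply/run_single; move: r; pose c := eval (K z) (fun=> Stuck).
(* Both states apply the same closure [c]; only the arguments differ. *)
change (run (app c (fun j => eval (M' j) (at0 c))) ->
  run (app (genv G K z) (fun j => eval (M j) (genv G K)))).
have -> : genv G K z = c by rewrite /genv Gz.
case: c => [|F e] r; first by case/runE: r.
apply/(@run_cneq _ _ (binds (fun j => eval (M' j) (fun=> Stuck)) e)).
  move=> x; rewrite /binds; case: insub => [j|]; first exact: cneq_close.
  exact: cneq_ceq (ceq_refl _).
apply: run_ceq r => x _; rewrite /binds; case: insub => [j|]; last exact: ceq_refl.
by apply: ceq_closed; exact: (aX _ _ (XM j)).
Qed.

Lemma ctx_orth_bind m G (P : 'I_m -> set pos) (N : 'I_m -> neg) K :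
  ctx_orth G K -> (forall j, pos_orth (P j) (N j)) ->
  ctx_orth (ctx_bind G P) (fun x => if insub x is Some j then N j else K (x - m)).
Proof.
move=> oK oN x Q; rewrite /ctx_bind; case: insub => [j [<-]|]; first exact: oN.
exact: oK.
Qed.

(** It suffices that the closed design lies in [conn_neg alpha P]. The triple orthogonal collapses,
    so it is tested on generators only, and there one machine step leads to a premise. *)
Lemma sem_neg_rule G n (alpha : connective ar n) (P : 'I_n -> set pos) (F : A -> pos) :
  id_free_neg (Sum F) -> fv (DNeg (Sum F)) `<=` dom G ->
  (forall a v, act alpha a = Some v ->
     sound (DPos (F a)) (ctx_bind G (fun j => P (v j))) None) ->
  sem (DNeg (Sum F)) G (Some (conn_neg alpha P)).
Proof.
move=> iF fF hF K Q oK [aQ oQ].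
apply/(run_cneq _ (fun x => cneq_at0 x (cneq_close G K (Sum F)))); apply/orthogonalE.
apply: oQ; rewrite /conn_neg /conn_pos neg_orthK; last first.
  by apply: (@atomic_actions n alpha (fun i => pos_orth (P i))) => i N [].
split; first exact: atomic_close.
move=> R [a [v [Ea [N XN e]]]]; apply/orthogonalE.
(* The closed form served for atomicity; the unnormalized closure is restored so that the step
   enters [F a]. *)
apply/(run_cneq _ (fun x => cneq_at0 x (cneq_close G K (Sum F)))).
have es : steq (R, at0 (eval (Sum F) (genv G K)))
    (single (Pre (Var _ x0) N), at0 (eval (Sum F) (genv G K))).
  by apply: steq_eq e _ => x _; apply: ceq_refl.
apply: run_steq (steq_sym es) _; apply/run_single => /=.
have [_ _ _ /(_ _ (ctx_orth_bind oK XN))] := hF a v Ea.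
apply: run_ceq => x _; rewrite /binds /genv /ctx_bind.
case: insub => [j|]; last exact: ceq_refl.
by apply: ceq_closed; have [] := XN j.
Qed.

(** The closed [N] lies in [pos_orth P], so it extends [K] to an assignment for the context of [D];
    the cut is the delayed substitution of that value for [z]. *)
Lemma sem_cut_rule D N G Xi z P : G z = None ->
  sound D (ctx_add G z P) Xi -> sound (DNeg N) G (Some (pos_orth P)) ->
  sem (subst (sub1 z N) D) G Xi.
Proof.
move=> Gz [_ _ hG hD] hN.
have aP : P `<=` @atomic_pos _ ar by apply: (hG z); rewrite /ctx_add eqxx.
have key K : ctx_orth G K -> exists2 K', ctx_orth (ctx_add G z P) K' &
    forall x, cneq (eval (sub1 z N x) (genv G K)) (genv (ctx_add G z P) K' x).
  move=> oK; exists (fun x => if x == z then close G K N else K x).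
    move=> x R; rewrite /ctx_add; case: eqP => [_ [<-]|_]; last exact: oK.
    by rewrite -neg_orthK //; apply: sound_close.
  move=> x; rewrite /genv /ctx_add /sub1; case: eqP => // _; first exact: cneq_close.
  exact: cneq_ceq (ceq_refl _).
case: D hD => [Q|M]; case: Xi => [X|] //= h K.
  move=> /key [K' oK' hK']; apply/run_subst; apply/run_cneq; first exact: hK'.
  exact: h.
move=> Q /key [K' oK' hK'] XQ; apply/run_cneq; last exact: h oK' XQ.
move=> x; apply: cneq_at0; apply: cneq_trans_ceq (cneq_eval M hK').
by apply: ceq_eval_subst => y; apply: ceq_refl.
Qed.

Lemma derivable_sound D G Xi : derivable D G Xi -> sound D G Xi.
Proof.
elim=> {D G Xi}.
- by move=> D E G Xi e _; apply: sound_eq.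
- move=> G z n alpha X a v M s lX Gz Ea _ IH; apply: sequent_sound => //.
  exact: sem_pos_rule lX Gz Ea IH.
- move=> G n alpha P F s _ _ IH; apply: sequent_sound => //.
  by case: s => _ [_ iF _] _ _ _ fF; apply: sem_neg_rule.
- move=> D N G Xi z P s Gz _ IHD _ IHN; apply: sequent_sound => //.
  exact: sem_cut_rule Gz IHD IHN.
Qed.

(** Gives every context an orthogonal assignment, without which [sem] could hold vacuously. All
    heads of an atomic positive design are [x0], so each conjunct meets a daimon after one step. *)
Lemma pos_orth_daimon (X : set pos) : X `<=` @atomic_pos _ ar ->
  pos_orth X (Sum (fun=> daimon ar)).
Proof.
have d e : run (daimon ar, e) by constructor=> -[].
move=> aX; split.
  split; last first.
    by apply/seteqP; split=> // y /fv_negE [a /fv_posE [[]]].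
  by split=> //; constructor=> a; constructor=> -[].
move=> P /aX [[/= nO cP _] fP]; apply/orthogonalE.
case: P nO cP fP => [|J S] // _ /cut_free_posE cP fP; constructor=> i.
have {}fP x : fv_pre x (S i) -> x = x0 by move=> hx; apply: fP; apply: fv_conj hx.
case: (S i) (cP i) fP => N0 a N /cut_free_preE [[x ->] _] fP /=.
have -> : x = x0 by apply: fP; apply: fv_head; constructor.
exact: d.
Qed.

End Soundness.

Theorem theorem3p7 (A : Type) (ar : A -> nat)
    (D : design ar) (G : ctx ar) (Xi : option (set (neg ar))) :
  derivable D G Xi -> models (nf D) G Xi.
Proof.
move=> /derivable_sound [iD fD hG h].
case: D Xi iD fD h => [P|N] [X|] //= iD fD h.
  have r K : ctx_orth G K -> run (nf_pos P, genv G K) by move/h/run_nf_pos.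
  split; last by move=> K oK; apply/run_pos_ctx; apply: r.
    split; [|exact: cut_free_nf_pos|exact: id_free_nf_pos].
    (* A single orthogonal assignment suffices to exclude [Omega], which never runs. *)
    move=> [E]; have /r : ctx_orth G (fun=> Sum (fun=> daimon ar)).
      by move=> x X /hG; apply: pos_orth_daimon.
    by rewrite E => /runE.
  by move=> x /fv_nf_pos; apply: fD.
split.
- by split=> //; [exact: cut_free_nf_neg|exact: id_free_nf_neg].
- by move=> x /fv_nf_neg; apply: fD.
- move=> K Q oK XQ; apply/run_neg_ctx.
  have e x : nceq (at0 (eval N (genv G K)) x) (at0 (eval (nf_neg N) (genv G K)) x).
    rewrite /at0; case: eqP => _; last exact: nceq_refl.
    by apply: nceq_eval_nf => y; apply: nceq_refl.
  by apply/(run_nceq _ e); apply: h.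
Qed.
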